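(* Let $(a_n)_{n\ge1}$ be a sequence of real numbers. For each $n\ge 1$ let $p_n(z)=z^n-a_1z^{n-1}-\cdots-a_{n-1}z-a_n$ and $r_n=\max\{|z|: z\in\mathbb{C},\ p_n(z)=0\}$. If there exists an index $n\geq 1$ such that $$r_n<1\quad\text{and}\quad\sum_{i=n+1}^{\infty}|a_i|<(1-r_n)^n,$$ then the null solution of the Volterra difference equation $x_n=\sum_{i=0}^{n-1}a_{n-i}x_i$, $n\ge 1$, is asymptotically stable.
   Context: A solution of the equation $x_n=\sum_{i=0}^{n-1}a_{n-i}x_i$ ($n\ge1$) is the sequence $(x_n)_{n\ge 0}$ generated recursively from an initial condition $x_0\in\mathbb{R}$. The null solution is the one with $x_0=0$. The null solution is stable if for every $\varepsilon>0$ there is $\delta>0$ such that $|x_0|<\delta$ implies $|x_n|<\varepsilon$ for all $n\ge 0$. It is asymptotically stable if it is stable and there is $\delta>0$ such that $|x_0|<\delta$ implies $x_n\to 0$ as $n\to\infty$. *)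

(* Defs.v *)
From HB Require Import structures.
From mathcomp Require Import all_boot all_order all_algebra.
From mathcomp Require Import boolp classical_sets reals ereal topology normedtype sequences.
From mathcomp Require Import complex.

Set Implicit Arguments.
Unset Strict Implicit.
Unset Printing Implicit Defensive.

Import Order.TTheory GRing.Theory Num.Theory.
Import numFieldNormedType.Exports.

Local Open Scope classical_set_scope.
Local Open Scope complex_scope.
Local Open Scope ring_scope.

(* Throughout, a sequence (a_n)_{n >= 1} is a function a : nat -> R whose value
   at 0 is never used. *)

Definition char_poly_seq (R : realType) (a : nat -> R) (n : nat) : {poly R[i]} :=
  'X^n - \sum_(1 <= i < n.+1) (a i)%:C *: 'X^(n - i).

Definition root_moduli (R : realType) (a : nat -> R) (n : nat) : set R :=
  [set ComplexField.Normc.normc z | z in [set z | root (char_poly_seq a n) z]].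

Definition is_max (R : realType) (A : set R) (m : R) : Prop := A m /\ ubound A m.

(* The default value 0 only matters when there is no maximum; root_radiusP
   rules this out for n >= 1. *)
Definition root_radius (R : realType) (a : nat -> R) (n : nat) : R :=
  xget 0 [set m | is_max (root_moduli a n) m].

Definition volterra_solution (R : realType) (a x : nat -> R) : Prop :=
  forall n, (1 <= n)%N -> x n = \sum_(0 <= i < n) a (n - i)%N * x i.

Definition null_stable (R : realType) (a : nat -> R) : Prop :=
  forall eps : R, 0 < eps -> exists2 delta : R, 0 < delta &
    forall x : nat -> R, volterra_solution a x ->
      `|x 0%N| < delta -> forall n, `|x n| < eps.

Definition null_asymptotically_stable (R : realType) (a : nat -> R) : Prop :=
  null_stable a /\
  exists2 delta : R, 0 < delta &
    forall x : nat -> R, volterra_solution a x ->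
      `|x 0%N| < delta -> x @ \oo --> (0 : R).

Lemma size_char_poly_seq (R : realType) (a : nat -> R) (n : nat) :
  size (char_poly_seq a n) = n.+1.
Proof.
rewrite /char_poly_seq size_polyDl ?size_polyXn// size_polyN ltnS.
rewrite big_seq; apply: (big_ind (fun p : {poly R[i]} => (size p <= n)%N)).
- by rewrite size_poly0.
- by move=> p q hp hq; rewrite (leq_trans (size_polyD _ _))// geq_max hp hq.
- move=> i; rewrite mem_index_iota => /andP[i0 iN].
  by rewrite (leq_trans (size_scale_leq _ _))// size_polyXn ltn_subrL i0 (leq_trans i0).
Qed.

Lemma root_radiusP (R : realType) (a : nat -> R) (n : nat) :
  (1 <= n)%N -> is_max (root_moduli a n) (root_radius a n).
Proof.
move=> n0; rewrite /root_radius; case: xgetP => [m _ //|noM]; exfalso.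
have p0 : char_poly_seq a n != 0 by rewrite -size_poly_eq0 size_char_poly_seq.
have [s ps] := closed_field_poly_normal (char_poly_seq a n).
have rootE z : root (char_poly_seq a n) z = (z \in s).
  by rewrite ps rootZ ?root_prod_XsubC// lead_coef_eq0.
have max_seq (t : seq R[i]) : t != [::] -> exists2 z, z \in t &
    forall w, w \in t -> ComplexField.Normc.normc w <= ComplexField.Normc.normc z.
  elim: t => // u [|v t] IH _.
    by exists u => [|w]; rewrite inE// => /eqP->.
  have [//|z zt zmax] := IH.
  have [uz|zu] := leP (ComplexField.Normc.normc u) (ComplexField.Normc.normc z).
    exists z => [|w]; first by rewrite inE zt orbT.
    by rewrite inE => /predU1P[->//|/zmax].
  exists u => [|w]; first by rewrite inE eqxx.
  rewrite inE => /predU1P[->//|/zmax /le_trans]; apply; exact: ltW.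
have sN0 : s != [::].
  apply/eqP => s0; have := size_char_poly_seq a n.
  rewrite ps s0 big_nil size_scale ?lead_coef_eq0// size_poly1 => -[n00].
  by rewrite -n00 in n0.
have [z zs zmax] := max_seq s sN0.
apply: (noM (ComplexField.Normc.normc z)); split.
  by exists z => //=; rewrite rootE.
by move=> _ [w /= + <-]; rewrite rootE => /zmax.
Qed.

Lemma volterra_solution_exists (R : realType) (a : nat -> R) (x0 : R) :
  exists2 x : nat -> R, x 0%N = x0 & volterra_solution a x.
Proof.
pose next (s : seq R) := \sum_(0 <= i < size s) a (size s - i)%N * s`_i.
pose l n := iter n (fun s => rcons s (next s)) [:: x0].
have size_l n : size (l n) = n.+1 by elim: n => //= n IH; rewrite size_rcons IH.
have nth_l i n : (i <= n)%N -> (l n)`_i = (l i)`_i.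
  elim: n => [|n IH]; first by rewrite leqn0 => /eqP->.
  rewrite leq_eqVlt => /predU1P[->//|]; rewrite ltnS => le_in.
  by rewrite /= nth_rcons size_l ltnS le_in IH.
exists (fun n => (l n)`_n) => // -[//|n] _.
rewrite /= nth_rcons size_l ltnn eqxx /next size_l.
by apply: eq_big_nat => i; rewrite ltnS => /andP[_ /nth_l ->].
Qed.

(* Main.v *)
Require Import Defs.
From mathcomp Require Import all_boot all_order all_algebra.
From mathcomp Require Import boolp classical_sets reals ereal topology normedtype sequences.
From mathcomp Require Import complex.

(** The theorem follows from an l1 estimate: every solution satisfies
    [sum_(m < M) |x_m| <= C |x_0|] with [C] independent of [M]
    ([volterra_l1_bound]).  This bounds each [|x_m|] by [C |x_0|], which is
    stability, and makes [sum |x_m|] converge, so that [x_m --> 0].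

    For the estimate, extend [x] by [0] to negative indices and move the first
    [N] coefficients to the left:
      [x_m - sum_(1 <= j <= N) a_j x_(m-j) = sum_(j > N) a_j x_(m-j)]
    for [m >= 1], while for [m = 0] the left-hand side is [x_0].  The left-hand
    side is the polynomial [p_N = prod_k (X - z_k)] applied to [x], where [X] is
    a shift.  A shift does not increase the l1 norm, so each factor [X - z_k]
    shrinks it at most by the factor [1 - |z_k| >= 1 - r_N]
    ([l1norm_prod_XsubC_ge]); the l1 norm of the left-hand side is thus at least
    [(1 - r_N)^N] times that of [x].  By Young's inequality for convolutions
    ([l1norm_conv_le]) the l1 norm of the right-hand side is at most
    [sum_(j > N) |a_j|] times that of [x].  The hypothesis says exactly that the
    second constant is smaller than the first.

    All sums are cut at an index [M].  The segment [x_0, ..., x_(M-1)] is stored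
    in reversed order as the coefficients of a polynomial: multiplying it by
    [p_N] and reading the coefficients of degree at least [N] then applies the
    recurrence above. *)

Import Order.TTheory GRing.Theory Num.Theory.
Import numFieldNormedType.Exports.

Local Open Scope ring_scope.

(** The coefficient of degree [i.+1] of [('X - z%:P) * P] is
    [P`_i - z * P`_i.+1], and the shifted sum of the [`|P`_i.+1|] is at most the
    sum of the [`|P`_i|] because [P`_K = 0]. *)
Lemma l1norm_XsubC_ge {F : numDomainType} (z : F) (P : {poly F}) (k K : nat) :
  (size P <= K)%N ->
  (1 - `|z|) * \sum_(k <= i < K) `|P`_i| <=
    \sum_(k.+1 <= i < K.+1) `|(('X - z%:P) * P)`_i|.
Proof.
move=> szP; have [Kk|kK] := leqP K k.
  by rewrite !big_geq// mulr0.
rewrite big_add1 /=.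
have shift_le : \sum_(k <= i < K) `|P`_i.+1| <= \sum_(k <= i < K) `|P`_i|.
  rewrite -(big_add1 _ _ k K.+1 xpredT (fun i => `|P`_i|)) big_nat_recr//=.
  by rewrite (nth_default 0 szP) normr0 addr0 [leRHS]big_ltn// lerDr.
apply: (@le_trans _ _ (\sum_(k <= i < K) (`|P`_i| - `|z| * `|P`_i.+1|))).
  rewrite sumrB -mulr_sumr mulrBl mul1r lerD2l lerN2.
  exact: ler_wpM2l.
apply: ler_sum => i _.
by rewrite mulrBl coefB coefXM coefCM /= -normrM lerB_dist.
Qed.

(** Each factor costs one power of [1 - r] and raises by one the degree from
    which the coefficients are summed; the low-degree coefficients, where a
    product with [P] involves no full window of [P], are never read. *)
Lemma l1norm_prod_XsubC_ge {F : numDomainType} (r : F) (s : seq F)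
    (P : {poly F}) (k K : nat) :
  r <= 1 -> (forall z, z \in s -> `|z| <= r) -> (size P <= K)%N ->
  (1 - r) ^+ size s * \sum_(k <= i < K) `|P`_i| <=
    \sum_(k + size s <= i < K + size s)
      `|(\prod_(z <- s) ('X - z%:P) * P)`_i|.
Proof.
move=> r1; elim: s P k K => [|z s IH] P k K sr szP.
  by rewrite expr0 mul1r big_nil mul1r !addn0.
rewrite big_cons [_ * \prod_(_ <- _) _]mulrC -mulrA /= -!addSnnS.
have szQ : (size (('X - z%:P) * P)%R <= K.+1)%N.
  by rewrite (leq_trans (size_polyMleq _ _))// size_XsubC.
apply: le_trans (IH _ k.+1 _ _ szQ); last first.
  by move=> w ws; rewrite sr// inE ws orbT.
rewrite exprSr -mulrA ler_wpM2l ?exprn_ge0 ?subr_ge0//.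
apply: le_trans (l1norm_XsubC_ge z _ k _ szP).
by rewrite ler_wpM2r ?sumr_ge0// lerD2l lerN2 sr ?mem_head.
Qed.

(** Young's inequality: after exchanging the two sums, the terms with factor
    [`|b j|] form a translate by [j] of the sum of the [`|x m|], which loses its
    last [j] terms. *)
Lemma l1norm_conv_le {F : numDomainType} (b x : nat -> F) (k l M : nat) :
  \sum_(0 <= m < M) `|\sum_(k <= j < l | (j <= m)%N) b j * x (m - j)%N| <=
    (\sum_(k <= j < l) `|b j|) * \sum_(0 <= m < M) `|x m|.
Proof.
apply: (@le_trans _ _ (\sum_(0 <= m < M) \sum_(k <= j < l | (j <= m)%N)
    `|b j| * `|x (m - j)%N|)).
  apply: ler_sum => m _; apply: le_trans (ler_norm_sum _ _ _) _.
  by apply: ler_sum => j _; rewrite normrM.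
rewrite (exchange_big_dep xpredT)//= mulr_suml.
apply: ler_sum => j _; rewrite -mulr_sumr ler_wpM2l//.
have [Mj|/ltnW jM] := leqP M j.
  rewrite [leLHS]big_nat_cond big_pred0 ?sumr_ge0// => m.
  by apply/negP => /andP[/andP[_ mM] jm]; move: (leq_trans mM Mj); rewrite ltnNge jm.
rewrite (big_cat_nat (leq0n j) jM) /= [X in X + _]big_nat_cond big_pred0 ?add0r; last first.
  by move=> m; rewrite ltnNge; case: (j <= m)%N; rewrite ?andbF.
rewrite -{1}[j]add0n big_addn.
under eq_bigl do rewrite leq_addl.
under eq_bigr do rewrite addnK.
rewrite [leRHS](big_cat_nat (leq0n (M - j)) (leq_subr j M)) /=.
by rewrite lerDl sumr_ge0.
Qed.

Section VolterraBound.
Variables (R : realType) (a : nat -> R).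

Local Notation p := (char_poly_seq a).
Local Notation r := (root_radius a).

Lemma char_poly_seq_split (n : nat) :
  exists2 s : seq R[i], p n = \prod_(z <- s) ('X - z%:P) & size s = n.
Proof.
have [s ps] := closed_field_poly_normal (p n).
have sz_p := size_char_poly_seq a n.
have lead1 : lead_coef (p n) = 1.
  rewrite lead_coefE sz_p /= coefB coefXn eqxx coef_sum big_nat big1 ?subr0//.
  move=> i /andP[i0 iN]; rewrite coefZ coefXn.
  by rewrite gtn_eqF ?mulr0// ltn_subrL i0 (leq_trans i0).
exists s; first by rewrite [LHS]ps lead1 scale1r.
by move: sz_p; rewrite ps lead1 scale1r size_prod_XsubC => -[].
Qed.

Lemma normc_root_le (n : nat) (z : R[i]) :
  (1 <= n)%N -> root (p n) z -> `|z| <= (r n)%:C%C.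
Proof.
move=> n0 pz; rewrite normc_def lecR.
case: (root_radiusP a n0) => _ rmax.
by have := rmax _ (ex_intro2 _ _ z pz erefl); case: z pz.
Qed.

(** The bound [l] is free so that the sum can be cut at [n.+1] whether or not
    [n < m]. *)
Lemma volterra_solution_conv (x : nat -> R) (m l : nat) :
  volterra_solution a x -> (1 <= m)%N -> (m < l)%N ->
  x m = \sum_(1 <= j < l | (j <= m)%N) a j * x (m - j)%N.
Proof.
move=> sol m0 ml; rewrite (sol m m0) (big_cat_nat _ ml)//=.
rewrite [X in _ + X]big_nat_cond [X in _ + X]big_pred0 ?addr0; last first.
  by move=> j; rewrite ltnNge; case: (j <= m)%N; rewrite ?andbF.
rewrite big_nat_rev /= add0n big_add1 /= [RHS]big_nat_cond [LHS]big_nat_cond.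
apply: eq_big => [j|j /andP[/andP[_ jm] _]]; first by rewrite /= andbT; case: (j < m)%N.
by rewrite subKn.
Qed.

(** The order is reversed because, in the recurrence, [x_m] carries the leading
    coefficient of the characteristic polynomial: with this order the polynomial
    acts by plain multiplication, without passing to its reciprocal.  The zero
    coefficients from degree [M] on stand for [x] at negative indices. *)
Definition reversed_segment (x : nat -> R) (M : nat) : {poly R[i]} :=
  \poly_(i < M) (x (M.-1 - i)%N)%:C%C.

(** The coefficient of degree [M - m.+1] of the segment is [x m], and ['X^n], the
    leading term of the polynomial, raises it to degree [n + (M - m.+1)]; the
    term ['X^(n - j)] brings [x (m - j)] to the same degree. *)
Lemma coef_char_poly_reversed_segment (x : nat -> R) (n M m : nat) :
  (m < M)%N ->
  (p n * reversed_segment x M)`_(n + (M - m.+1)) =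
    (x m - \sum_(1 <= j < n.+1 | (j <= m)%N) a j * x (m - j)%N)%:C%C.
Proof.
move=> mM; rewrite mulrBl coefB coefXnM ltnNge leq_addr /= addKn rmorphB /=.
have M1 : (M - m.+1 = M.-1 - m)%N by case: M mM => // M _; rewrite subSS.
have mM1 : (m <= M.-1)%N by case: M mM {M1}.
congr (_ - _).
  by rewrite coef_poly M1 subKn// -M1 ltn_subrL (leq_trans _ mM).
rewrite mulr_suml coef_sum rmorph_sum /= [RHS]big_mkcond /= 2!big_nat.
apply: eq_bigr => j /andP[j1 jn]; rewrite ltnS in jn.
rewrite -scalerAl coefZ coefXnM ltnNge.
have jle : (n - j <= n + (M - m.+1))%N by rewrite (leq_trans (leq_subr _ _)) ?leq_addr.
have -> : (n + (M - m.+1) - (n - j) = M.-1 - m + j)%N.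
  by rewrite M1 -{1}(subnK jn) -addnA addKn addnC.
rewrite jle /= coef_poly subnDA subKn//; case: (leqP j m) => [jm|mj].
  rewrite ifT ?rmorphM// -(ltn_predK mM) ltnS.
  by rewrite -[leqRHS](subnK mM1) leq_add2l.
rewrite ifF ?mulr0//; apply/negbTE; rewrite -leqNgt.
by rewrite -(prednK (leq_ltn_trans (leq0n m) mM)) -{1}(subnK mM1) -addnS leq_add2l.
Qed.

(** This is where the roots enter: the right-hand side consists of the top [M]
    coefficients of the product of the reversed segment with [n] factors
    ['X - z%:P], all with [`|z| <= r n < 1]. *)
Lemma l1norm_char_poly_ge (x : nat -> R) (n M : nat) :
  (1 <= n)%N -> r n < 1 ->
  (1 - r n) ^+ n * \sum_(0 <= m < M) `|x m| <=
    \sum_(0 <= m < M)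
      `|x m - \sum_(1 <= j < n.+1 | (j <= m)%N) a j * x (m - j)%N|.
Proof.
move=> n0 r1; have [s ps sz] := char_poly_seq_split n.
have sr z : z \in s -> `|z| <= (r n)%:C%C.
  by move=> zs; apply: normc_root_le => //; rewrite ps root_prod_XsubC.
have r1C : (r n)%:C%C <= 1 :> R[i] by rewrite lecR ltW.
have szP : (size (reversed_segment x M) <= M)%N by exact: size_poly.
have := l1norm_prod_XsubC_ge _ _ _ 0 _ r1C sr szP.
have normE (u : R) : `|u%:C%C| = `|u|%:C%C :> R[i].
  by rewrite normc_def /= expr0n /= addr0 sqrtr_sqr.
rewrite -ps sz big_addn addnK.
rewrite [X in _ * X]big_nat_rev [X in _ <= X]big_nat_rev /= !add0n.
have -> : \sum_(0 <= i < M) `|(reversed_segment x M)`_(M - i.+1)| =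
          (\sum_(0 <= m < M) `|x m|)%:C%C.
  rewrite rmorph_sum /=; apply: eq_big_nat => m /andP[_ mM].
  rewrite -normE coef_poly; case: M mM {szP} => // M mM.
  by rewrite subSS subKn// ltnS leq_subr.
have -> : \sum_(0 <= i < M) `|(p n * reversed_segment x M)`_(M - i.+1 + n)| =
  (\sum_(0 <= m < M)
     `|x m - \sum_(1 <= j < n.+1 | (j <= m)%N) a j * x (m - j)%N|)%:C%C.
  rewrite rmorph_sum /=; apply: eq_big_nat => m /andP[_ mM].
  by rewrite addnC coef_char_poly_reversed_segment// normE.
by rewrite -(rmorph1 (real_complex R)) -rmorphB -rmorphXn -rmorphM /= lecR.
Qed.

(** Applying the first [n] coefficients of the equation leaves the residual [y]
    made of the remaining ones, plus [x 0] at the index [0], where the equation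
    does not hold.  Young's inequality bounds the residual by [S] times the
    l1 norm of [x], and this term is absorbed on the left. *)
Lemma volterra_l1_bound (x : nat -> R) (n M : nat) (S : R) :
  (1 <= n)%N -> r n < 1 -> volterra_solution a x ->
  (forall l, \sum_(n.+1 <= j < l) `|a j| <= S) ->
  ((1 - r n) ^+ n - S) * \sum_(0 <= m < M) `|x m| <= `|x 0%N|.
Proof.
move=> n0 r1 sol leS; rewrite mulrBl lerBlDr.
apply: le_trans (l1norm_char_poly_ge x n M n0 r1) _.
pose l := (n.+1 + M)%N.
pose y m := \sum_(n.+1 <= j < l | (j <= m)%N) a j * x (m - j)%N.
apply: (@le_trans _ _ (\sum_(0 <= m < M) ((if m == 0%N then `|x 0%N| else 0) + `|y m|))).
  apply: ler_sum_nat => -[_|m /andP[_ mM]] /=.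
    rewrite big_nat_cond big_pred0 ?subr0 ?lerDl//.
    by case=> // j; rewrite andbF.
  rewrite add0r [x m.+1](volterra_solution_conv x m.+1 l)//; last first.
    by rewrite (leq_trans mM)// leq_addl.
  by rewrite [X in X - _](@big_cat_nat _ _ _ n.+1)// ?leq_addr//= addrAC subrr add0r.
rewrite big_split /= lerD//.
  case: M @l @y => [|M] _ _; first by rewrite big_geq.
  by rewrite big_nat_recl//= big1 ?addr0.
apply: le_trans (l1norm_conv_le _ _ _ _ _) _.
by rewrite ler_wpM2r ?sumr_ge0.
Qed.

End VolterraBound.

Theorem theorem13 (R : realType) (a : nat -> R)
  (ha : exists n : nat,
     [/\ (1 <= n)%N,
         root_radius a n < 1
       & (\sum_(n.+1 <= i <oo) `|a i|%:E < ((1 - root_radius a n) ^+ n)%:E)%E]) :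
  null_asymptotically_stable a.
Proof.
case: ha => n [n0 r1 hS].
have tail_le l : ((\sum_(n.+1 <= j < l) `|a j|)%:E <=
    \sum_(n.+1 <= i <oo) `|a i|%:E)%E.
  rewrite -sumEFin.
  by apply: (@nneseries_lim_ge _ (fun i => `|a i|%:E) xpredT n.+1) => i _ _; rewrite lee_fin.
(* The sum of the tail is finite, being smaller than a real number. *)
have [S leS Slt] : exists2 S, forall l, \sum_(n.+1 <= j < l) `|a j| <= S &
    S < (1 - root_radius a n) ^+ n.
  case: (\sum_(n.+1 <= i <oo) `|a i|%:E)%E hS tail_le => [S| |] hS tail_le //.
  - by exists S => [l|]; [rewrite -lee_fin|rewrite -lte_fin].
  - by have := tail_le 0%N.
pose c := (1 - root_radius a n) ^+ n - S.
have c0 : 0 < c by rewrite subr_gt0.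
have l1_le x M : volterra_solution a x -> \sum_(0 <= m < M) `|x m| <= c^-1 * `|x 0%N|.
  move=> sol; rewrite ler_pdivlMl//.
  exact: volterra_l1_bound.
split.
  move=> eps eps0; exists (c * eps) => [|x sol x0 m]; first exact: mulr_gt0.
  apply: (@le_lt_trans _ _ (c^-1 * `|x 0%N|)); last by rewrite ltr_pdivrMl.
  apply: le_trans (l1_le x m.+1 sol).
  by rewrite big_nat_recr//= lerDr sumr_ge0.
exists 1 => // x sol _; apply: cvg_series_cvg_0.
apply: normed_cvg; apply: nondecreasing_is_cvgn.
  by apply: (@nondecreasing_series _ (fun m => `|x m|) xpredT 0%N) => m _ _; exact: normr_ge0.
by exists (c^-1 * `|x 0%N|) => _ [M _ <-]; apply: l1_le.
Qed.
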